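(* Let $n$ be a positive integer, let $0 < r < 1$, and let $0<\alpha<\pi/2$ satisfy $\sin\alpha \le r \le \cos\alpha$. Let $C \subset \mathbb{R}^n$ be a compact set with $rB^n \subseteq C \subseteq B^n$, and let $v, w \in \mathbb{R}^n$ be two nonzero vectors making an angle $\alpha$. Then, with $\rho := \sqrt{1-r^2}$, $$\mathrm{scaled\_loss}(v,w) \le \frac{2\rho\sin\alpha}{r(1+\cos\alpha)+\rho\sin\alpha}.$$ Moreover, this bound is tight: for every $r$ and $\alpha$ with $0<r<1$, $0<\alpha<\pi/2$ and $\sin\alpha\le r\le\cos\alpha$, there exist $n$, a compact set $C$ with $rB^n \subseteq C\subseteq B^n$, and nonzero vectors $v,w\in\mathbb{R}^n$ making an angle $\alpha$, for which equality holds.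
   Context: $B^n := \{x\in\mathbb{R}^n : \|x\|\le 1\}$ is the closed Euclidean unit ball and $rB^n$ the closed ball of radius $r$ centered at the origin. For a nonempty compact set $C \subset \mathbb{R}^n$ and $v,w \in \mathbb{R}^n$, define $\max(v) := \max\{v^Tx : x \in C\}$, $\min(v) := \min\{v^Tx : x\in C\}$, $\mathrm{range}(v) := \max(v)-\min(v)$, $\mathrm{loss}(v,w) := \max(w) - \min\{w^Tx : x \in C,\ v^Tx = \max(v)\}$, and $\mathrm{scaled\_loss}(v,w) := \mathrm{loss}(v,w)/\mathrm{range}(w)$. *)

(* Defs.v *)
From HB Require Import structures.
From mathcomp Require Import all_boot all_order all_algebra.
From mathcomp Require Import all_classical all_reals all_analysis.
Set Implicit Arguments.
Unset Strict Implicit.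
Unset Printing Implicit Defensive.
Import Order.TTheory GRing.Theory Num.Theory.
Import numFieldNormedType.Exports.
Local Open Scope classical_set_scope.
Local Open Scope ring_scope.

(* Points of R^n are row vectors, so v^T x is the entry of v *m x^T.
   The library norm `|x| on 'rV[R]_n is the sup norm, hence [enorm] below; both
   norms induce the library topology, to which [compact] refers. *)

Definition dot (R : realType) (n : nat) (v x : 'rV[R]_n) : R :=
  (v *m x^T) 0 0.

Definition enorm (R : realType) (n : nat) (x : 'rV[R]_n) : R :=
  Num.sqrt (dot x x).

Definition cball (R : realType) (n : nat) (r : R) : set 'rV[R]_n :=
  [set x | enorm x <= r].
Arguments cball {R} n r.

Definition angle (R : realType) (n : nat) (v w : 'rV[R]_n) : R :=
  acos (dot v w / (enorm v * enorm w)).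

(* For nonempty compact C the suprema and infima below are attained, hence are
   maxima and minima: see [maxval_max], [minval_min] and [face_min]. *)

Definition maxval (R : realType) (n : nat) (C : set 'rV[R]_n)
    (v : 'rV[R]_n) : R :=
  sup [set dot v x | x in C].

Definition minval (R : realType) (n : nat) (C : set 'rV[R]_n)
    (v : 'rV[R]_n) : R :=
  inf [set dot v x | x in C].

Definition rangeval (R : realType) (n : nat) (C : set 'rV[R]_n)
    (v : 'rV[R]_n) : R :=
  maxval C v - minval C v.

Definition face (R : realType) (n : nat) (C : set 'rV[R]_n)
    (v : 'rV[R]_n) : set 'rV[R]_n :=
  [set x | C x /\ dot v x = maxval C v].

Definition loss (R : realType) (n : nat) (C : set 'rV[R]_n)
    (v w : 'rV[R]_n) : R :=
  maxval C w - inf [set dot w x | x in face C v].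

Definition scaled_loss (R : realType) (n : nat) (C : set 'rV[R]_n)
    (v w : 'rV[R]_n) : R :=
  loss C v w / rangeval C w.

Lemma dotE (R : realType) (n : nat) (v x : 'rV[R]_n) :
  dot v x = \sum_i v 0 i * x 0 i.
Proof. by rewrite /dot mxE; apply: eq_bigr => i _; rewrite mxE. Qed.

Lemma dot_continuous (R : realType) (n : nat) (v : 'rV[R]_n) :
  continuous (dot v : 'rV[R]_n -> R).
Proof.
have -> : dot v = (fun x : 'rV[R]_n => \sum_i v 0 i * x 0 i).
  by apply/funext => x; rewrite dotE.
elim: (index_enum _) => [|i s IHs].
  rewrite (_ : (fun _ => _) = cst 0); first exact: cst_continuous.
  by apply/funext => x; rewrite big_nil.
rewrite (_ : (fun _ => _) =
    (fun x : 'rV[R]_n => v 0 i * x 0 i + \sum_(j <- s) v 0 j * x 0 j)); last first.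
  by apply/funext => x; rewrite big_cons.
move=> x; apply: (@cvgD R R^o _ (nbhs x) (nbhs_filter x)
    (fun y : 'rV[R]_n => v 0 i * y 0 i)); last exact: IHs.
apply: (@cvgM R _ (nbhs x) (nbhs_filter x)
    (cst (v 0 i)) (fun y : 'rV[R]_n => y 0 i)); first exact: cvg_cst.
exact: coord_continuous.
Qed.

Lemma maxval_max (R : realType) (n : nat) (C : set 'rV[R]_n) (v : 'rV[R]_n) :
  C !=set0 -> compact C ->
  exists x, [/\ C x, dot v x = maxval C v & forall y, C y -> dot v y <= dot v x].
Proof.
move=> C0 cC.
have [x xC xmax] := compact_EVT_max C0 cC
  (continuous_subspaceT (@dot_continuous R n v)).
rewrite inE in xC; have xm y : C y -> dot v y <= dot v x.
  by move=> Cy; apply: xmax; rewrite inE.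
exists x; split=> //; apply/eqP; rewrite eq_le; apply/andP; split.
  apply: ub_le_sup; last by exists x.
  by exists (dot v x) => _ [y Cy <-]; exact: xm.
apply: ge_sup; first by exists (dot v x), x.
by move=> _ [y Cy <-]; exact: xm.
Qed.

Lemma minval_min (R : realType) (n : nat) (C : set 'rV[R]_n) (v : 'rV[R]_n) :
  C !=set0 -> compact C ->
  exists x, [/\ C x, dot v x = minval C v & forall y, C y -> dot v x <= dot v y].
Proof.
move=> C0 cC.
have [x xC xmin] := compact_EVT_min C0 cC
  (continuous_subspaceT (@dot_continuous R n v)).
rewrite inE in xC; have xm y : C y -> dot v x <= dot v y.
  by move=> Cy; apply: xmin; rewrite inE.
exists x; split=> //; apply/eqP; rewrite eq_le; apply/andP; split.
  apply: lb_le_inf; first by exists (dot v x), x.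
  by move=> _ [y Cy <-]; exact: xm.
apply: ge_inf; last by exists x.
by exists (dot v x) => _ [y Cy <-]; exact: xm.
Qed.

Lemma face_min (R : realType) (n : nat) (C : set 'rV[R]_n) (v w : 'rV[R]_n) :
  C !=set0 -> compact C ->
  exists x, [/\ face C v x, dot w x = inf [set dot w y | y in face C v]
              & forall y, face C v y -> dot w x <= dot w y].
Proof.
move=> C0 cC; apply: (@minval_min R n (face C v) w).
  by have [x [Cx xE _]] := maxval_max v C0 cC; exists x.
rewrite (_ : face C v = C `&` (dot v @^-1` [set maxval C v])) //.
apply: compact_closedI => //; apply: preimage_closed => [x _|]; first exact: dot_continuous.
exact: closed_eq.
Qed.

(* Main.v *)
(* Normalise v and w and let h be the maximum of v over C, so h >= r. By
   Cauchy-Schwarz orthogonally to v, every x in C satisfies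
   |w.x - c (v.x)| <= s sqrt (1 - (v.x)^2), with c = cos alpha, s = sin alpha.
   This bounds w from below on the face v.x = h, and bounds max w from above by
   c h + s sqrt (1 - h^2) if h <= c and by 1 otherwise; with min w <= - r the
   ratio is then largest at h = r. Equality holds in the plane for the unit disc
   cut by the half-planes v.x <= r and w.x >= - r. *)
Require Import Defs.
From HB Require Import structures.
From mathcomp Require Import all_boot all_order all_algebra.
From mathcomp Require Import all_classical all_reals all_analysis.
From mathcomp Require Import ring lra.
Set Implicit Arguments.
Unset Strict Implicit.
Unset Printing Implicit Defensive.
Import Order.TTheory GRing.Theory Num.Theory.
Import numFieldNormedType.Exports.
Local Open Scope classical_set_scope.
Local Open Scope ring_scope.

(** * Inner product, Euclidean norm and Cauchy-Schwarz *)

Lemma dotC (R : realType) (n : nat) (x y : 'rV[R]_n) : dot x y = dot y x.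
Proof. by rewrite !dotE; apply: eq_bigr => i _; rewrite mulrC. Qed.

Lemma dotDr (R : realType) (n : nat) (x y z : 'rV[R]_n) :
  dot x (y + z) = dot x y + dot x z.
Proof.
by rewrite !dotE -big_split; apply: eq_bigr => i _; rewrite mxE mulrDr.
Qed.

Lemma dotZr (R : realType) (n : nat) (a : R) (x y : 'rV[R]_n) :
  dot x (a *: y) = a * dot x y.
Proof.
by rewrite !dotE mulr_sumr; apply: eq_bigr => i _; rewrite mxE mulrCA.
Qed.

Lemma dotZl (R : realType) (n : nat) (a : R) (x y : 'rV[R]_n) :
  dot (a *: x) y = a * dot x y.
Proof. by rewrite dotC dotZr dotC. Qed.

Lemma dotDl (R : realType) (n : nat) (x y z : 'rV[R]_n) :
  dot (x + y) z = dot x z + dot y z.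
Proof. by rewrite dotC dotDr !(dotC z). Qed.

Lemma dot0l (R : realType) (n : nat) (x : 'rV[R]_n) : dot 0 x = 0.
Proof. by rewrite -(scale0r 0) dotZl mul0r. Qed.

Lemma dot_ge0 (R : realType) (n : nat) (x : 'rV[R]_n) : 0 <= dot x x.
Proof. by rewrite dotE; apply: sumr_ge0 => i _; rewrite -expr2 sqr_ge0. Qed.

Lemma dot_eq0 (R : realType) (n : nat) (x : 'rV[R]_n) :
  (dot x x == 0) = (x == 0).
Proof.
apply/eqP/eqP => [|->]; last exact: dot0l.
rewrite dotE => /psumr_eq0P H; apply/rowP => i; rewrite mxE.
have /eqP : x 0 i * x 0 i = 0 by apply: H => // j _; rewrite -expr2 sqr_ge0.
by rewrite mulf_eq0 orbb => /eqP.
Qed.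

Lemma sqr_enorm (R : realType) (n : nat) (x : 'rV[R]_n) :
  enorm x ^+ 2 = dot x x.
Proof. by rewrite /enorm sqr_sqrtr ?dot_ge0. Qed.

Lemma enorm_gt0 (R : realType) (n : nat) (x : 'rV[R]_n) :
  (0 < enorm x) = (x != 0).
Proof. by rewrite sqrtr_gt0 lt_def dot_eq0 dot_ge0 andbT. Qed.

Lemma cballP (R : realType) (n : nat) (r : R) (x : 'rV[R]_n) :
  0 <= r -> cball n r x <-> dot x x <= r ^+ 2.
Proof.
move=> r0; rewrite -sqr_enorm ler_sqr ?nnegrE ?sqrtr_ge0 //.
Qed.

Lemma cauchy_schwarz (R : realType) (n : nat) (x y : 'rV[R]_n) :
  dot x y ^+ 2 <= dot x x * dot y y.
Proof.
have [->|x0] := eqVneq x 0; first by rewrite !dot0l expr0n mul0r.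
have xx : 0 < dot x x by rewrite lt_def dot_eq0 x0 dot_ge0.
(* This vector is [dot x x] times the component of [y] orthogonal to [x]; scaling by [dot x x]
   avoids a division. *)
have := dot_ge0 (dot x x *: y + (- dot x y) *: x).
rewrite !(dotDl, dotDr, dotZl, dotZr) (dotC y x) => H.
rewrite -subr_ge0 -(pmulr_rge0 _ xx); apply: le_trans H _.
by rewrite le_eqVlt; apply/orP; left; apply/eqP; ring.
Qed.

Lemma unit_dot_bound (R : realType) (n : nat) (r : R) (v x : 'rV[R]_n) :
  0 <= r -> dot v v = 1 -> dot x x <= r ^+ 2 -> `|dot v x| <= r.
Proof.
move=> r0 v1 xr; rewrite -ler_sqr ?nnegrE // real_normK ?num_real //.
by apply: le_trans (cauchy_schwarz v x) _; rewrite v1 mul1r.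
Qed.

(* Cauchy-Schwarz for the components of [w] and [x] orthogonal to [v]. *)
Lemma dot_deviation (R : realType) (n : nat) (c s : R) (v w x : 'rV[R]_n) :
  dot v v = 1 -> dot w w = 1 -> dot v w = c -> 0 <= s ->
  c ^+ 2 + s ^+ 2 = 1 -> dot x x <= 1 ->
  `|dot w x - c * dot v x| <= s * Num.sqrt (1 - dot v x ^+ 2).
Proof.
move=> v1 w1 vw s0 cs x1.
have vx : dot v x ^+ 2 <= 1.
  by apply: le_trans (cauchy_schwarz v x) _; rewrite v1 mul1r.
rewrite -ler_sqr ?nnegrE ?mulr_ge0 ?sqrtr_ge0 //.
rewrite real_normK ?num_real // exprMn sqr_sqrtr ?subr_ge0 //.
have := cauchy_schwarz (w + (- c) *: v) (x + (- dot v x) *: v).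
rewrite !(dotDl, dotDr, dotZl, dotZr) (dotC w v) (dotC x v) v1 w1 vw.
rewrite (_ : dot w x + _ + _ = dot w x - c * dot v x); last by ring.
move=> /le_trans; apply.
rewrite (_ : 1 + _ + _ = s ^+ 2); last by rewrite -[X in X + _ + _]cs; ring.
by rewrite ler_wpM2l ?sqr_ge0 // -subr_ge0; nra.
Qed.

(** * Inequalities in the plane *)

(** The points [(g, p)], [(h, q)] and [(c, s)] lie on the unit circle, and the functional with
    direction [(c, s)] increases along the upper arc until the abscissa reaches [c]. After
    multiplication by [q], the bound [p * q <= 1 - g * h] leaves a difference of at least
    [(h - g) * (c * q - s * h)]. *)
Lemma arc_le (R : realType) (c s g h p q : R) :
  0 < s -> c ^+ 2 + s ^+ 2 = 1 -> g <= h -> 0 < h -> h <= c ->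
  p ^+ 2 = 1 - g ^+ 2 -> 0 <= q -> q ^+ 2 = 1 - h ^+ 2 ->
  c * g + s * p <= c * h + s * q.
Proof.
move=> s0 cs gh h0 hc pE q0 qE.
have hc2 : h ^+ 2 <= c ^+ 2 by rewrite ler_sqr ?nnegrE //; lra.
have sq : s <= q by rewrite -ler_sqr ?nnegrE ?(ltW s0) //; lra.
have q1 : 0 < q by lra.
have pq : p * q <= 1 - g * h.
  have := sqr_ge0 (p - q); have := sqr_ge0 (g - h); rewrite !sqrrB; lra.
have sh : s * h <= q * c by apply: ler_pM => //; exact: ltW.
have X : 0 <= (h - g) * (c * q - s * h) by apply: mulr_ge0; lra.
rewrite -(ler_pM2r q1).
have : s * (p * q) <= s * (1 - g * h) by rewrite ler_wpM2l // ltW.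
have -> : (c * h + s * q) * q = c * h * q + s * q ^+ 2 by ring.
rewrite qE; lra.
Qed.

(* The planar form of the estimate: [h] is the maximum of [v], attained at a
   point where [w] takes the value [t]; [M] and [m] are the extrema of [w], and
   [g] is the value of [v] at a maximizer of [w]. *)
Lemma planar_bound (R : realType) (r c s rho h q g p M t m : R) :
  0 < r -> r <= c -> 0 < s -> s <= r -> c ^+ 2 + s ^+ 2 = 1 ->
  0 <= rho -> rho ^+ 2 = 1 - r ^+ 2 -> r <= h ->
  0 <= q -> q ^+ 2 = 1 - h ^+ 2 -> c * h - s * q <= t ->
  g <= h -> p ^+ 2 = 1 - g ^+ 2 -> M <= c * g + s * p -> M <= 1 ->
  r <= M -> m <= - r ->
  (M - t) / (M - m) <= 2 * rho * s / (r * (1 + c) + rho * s).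
Proof.
move=> r0 rc s0 sr cs rho0 rhoE rh q0 qE tge gh pE Mle M1 rM mr.
have h0 : 0 < h by lra.
have c0 : 0 < c by lra.
have sqle (a b : R) : 0 <= a -> a <= b -> a ^+ 2 <= b ^+ 2.
  by move=> a0 ab; rewrite ler_sqr ?nnegrE //; lra.
have rc2 := sqle _ _ (ltW r0) rc.
have rh2 := sqle _ _ (ltW r0) rh.
have srho : s <= rho by rewrite -ler_sqr ?nnegrE ?(ltW s0) //; lra.
have qrho : q <= rho by rewrite -ler_sqr ?nnegrE //; lra.
have rho1 : rho <= 1.
  by rewrite -ler_sqr ?nnegrE ?expr1n //; have := sqr_ge0 r; lra.
have rhos : rho * s <= r.
  by apply: le_trans sr; rewrite ler_piMl // ltW.
have rc0 : 0 < r * c by apply: mulr_gt0.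
have rhos0 : 0 <= rho * s by apply: mulr_ge0; lra.
set D := r * (1 + c) + rho * s.
have D0 : 0 < D by rewrite /D mulrDr; lra.
have K : 0 <= D - 2 * rho * s by rewrite /D mulrDr; lra.
suff H : (M - t) * D <= 2 * rho * s * (M - m).
  rewrite ler_pdivrMr; last by lra.
  by rewrite mulrAC ler_pdivlMr.
(* Since [m <= - r], the worst case is [m = - r]. *)
have H0 : 2 * (rho * s) * (M + r) <= 2 * (rho * s) * (M - m).
  by rewrite ler_wpM2l //; lra.
(* By [K] the coefficient of [M] is nonnegative, so [M] may be replaced by any upper bound, and [t]
   by its lower bound. *)
suff H : (D - 2 * rho * s) * M <= t * D + 2 * rho * s * r by lra.
have tD : (c * h - s * q) * D <= t * D by rewrite ler_wpM2r // ltW.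
have [hc|ch] := leP h c.
  have Mh : M <= c * h + s * q by apply: le_trans Mle _; exact: arc_le.
  have : (D - 2 * rho * s) * M <= (D - 2 * rho * s) * (c * h + s * q).
    by rewrite ler_wpM2l.
  (* Expanding [D], this holds term by term: [q <= rho] and [r <= h] handle [r] and [r * c], and the
     terms in [rho * s * q] agree. *)
  suff : s * (q * D) <= s * (rho * (c * h + s * q + r)) by lra.
  rewrite ler_pM2l //.
  have : q * r <= rho * r by rewrite ler_wpM2r // ltW.
  have : q * (r * c) <= rho * (h * c).
    by rewrite ler_pM ?(ltW s0) ?(ltW rc0) ?ler_pM2r.
  rewrite /D; lra.
(* For [h > c] the bounds [M <= 1] and [q <= s] reduce the claim to its instance at [h = c],
   [q = s]. *)
have ch2 := sqle _ _ (ltW c0) (ltW ch).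
have qs : q <= s by rewrite -ler_sqr ?nnegrE ?(ltW s0) //; lra.
have : (D - 2 * rho * s) * M <= (D - 2 * rho * s) * 1 by rewrite ler_wpM2l.
have : (c * c - s * s) * D <= (c * h - s * q) * D.
  have : c * c <= c * h by rewrite ler_wpM2l ?(ltW c0) ?ltW.
  have : s * q <= s * s by rewrite ler_wpM2l ?(ltW s0).
  by move=> ? ?; rewrite ler_wpM2r ?(ltW D0) //; lra.
have -> : c * c = 1 - s * s by rewrite -!expr2; lra.
suff : s * (s * D) <= s * (rho * (1 + r)) by lra.
rewrite ler_pM2l //.
have : s * r <= rho * r by rewrite ler_wpM2r // ltW.
have : s * (r * c) <= rho * (c * c).
  by rewrite ler_pM ?(ltW s0) ?(ltW rc0) ?ler_pM2r.
have -> : c * c = 1 - s * s by rewrite -!expr2; lra.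
rewrite /D; lra.
Qed.

(** * Compactness of Euclidean balls *)

Lemma closed_halfspace (R : realType) (n : nat) (a : R) (v : 'rV[R]_n) :
  closed [set x | dot v x <= a].
Proof.
apply: (@preimage_closed _ _ (dot v) [set y | y <= a]); last exact: closed_le.
by move=> x _; exact: dot_continuous.
Qed.

(** One inclusion is Cauchy-Schwarz, the other takes [u = x]. This form makes the ball closed, as an
    intersection of closed half-spaces. *)
Lemma cball_halfspaces (R : realType) (n : nat) (r : R) :
  0 <= r ->
  cball n r = \bigcap_(u : 'rV[R]_n) [set x | dot u x <= r * enorm u].
Proof.
move=> r0; apply/seteqP; split=> x /=.
  move=> /(cballP x r0) xr u _ /=; apply: le_trans (ler_norm _) _.
  rewrite -ler_sqr ?nnegrE ?mulr_ge0 ?sqrtr_ge0 //.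
  rewrite real_normK ?num_real // exprMn sqr_enorm mulrC.
  by apply: le_trans (cauchy_schwarz u x) _; rewrite ler_wpM2l ?dot_ge0.
move=> /(_ x I) /=; rewrite -sqr_enorm expr2.
have [->|x0] := eqVneq x 0; first by move=> _; apply/cballP; rewrite ?dot0l ?sqr_ge0.
by rewrite ler_pM2r ?enorm_gt0.
Qed.

(** The ball is a closed subset of a cube, which is compact as a product of segments. *)
Lemma compact_cball (R : realType) (n : nat) (r : R) :
  0 <= r -> compact (cball n r).
Proof.
move=> r0; apply: (@subclosed_compact _ _
    [set v : 'rV[R]_n | forall i, `[- r, r]%classic (v ord0 i)]).
- rewrite cball_halfspaces //; apply: closed_bigI => u _.
  exact: closed_halfspace.
- by apply: (@rV_compact _ _ (fun=> `[- r, r]%classic)) => _; exact: segment_compact.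
- move=> x /(cballP _ r0) xr i; rewrite /= in_itv /= -ler_norml.
  rewrite -ler_sqr ?nnegrE // real_normK ?num_real //.
  apply: le_trans xr; rewrite dotE (bigD1 i) //= -expr2 lerDl.
  by apply: sumr_ge0 => j _; rewrite -expr2 sqr_ge0.
Qed.

(** * The upper bound *)

Lemma scaled_loss_le (R : realType) (n : nat) (r c s : R) (C : set 'rV[R]_n)
    (v w : 'rV[R]_n) :
  0 < r -> r <= c -> 0 < s -> s <= r -> c ^+ 2 + s ^+ 2 = 1 ->
  compact C -> cball n r `<=` C -> C `<=` cball n 1 ->
  v != 0 -> w != 0 -> dot v w = c * (enorm v * enorm w) ->
  scaled_loss C v w <= 2 * Num.sqrt (1 - r ^+ 2) * s
    / (r * (1 + c) + Num.sqrt (1 - r ^+ 2) * s).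
Proof.
move=> r0 rc s0 sr cs cC rC C1 v0 w0 vw; set rho := Num.sqrt _.
have C0 : C !=set0.
  by exists 0; apply/rC/cballP; rewrite ?dot0l ?sqr_ge0 // ltW.
rewrite -enorm_gt0 in v0; rewrite -enorm_gt0 in w0.
set v' := (enorm v)^-1 *: v; set w' := (enorm w)^-1 *: w.
have vE x : dot v x = enorm v * dot v' x by rewrite dotZl mulVKf ?gt_eqF.
have wE x : dot w x = enorm w * dot w' x by rewrite dotZl mulVKf ?gt_eqF.
have v1 : dot v' v' = 1.
  by rewrite dotZl dotZr -sqr_enorm; field; rewrite gt_eqF.
have w1 : dot w' w' = 1.
  by rewrite dotZl dotZr -sqr_enorm; field; rewrite gt_eqF.
have vw' : dot v' w' = c.
  by rewrite dotZl dotZr vw; field; rewrite !gt_eqF.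
have CB x : C x -> dot x x <= 1.
  by move=> /C1 /(cballP x ler01); rewrite expr1n.
have dev x : C x -> `|dot w' x - c * dot v' x|
    <= s * Num.sqrt (1 - dot v' x ^+ 2).
  by move=> Cx; apply: dot_deviation => //; [exact: ltW|exact: CB].
have sqE x : C x -> Num.sqrt (1 - dot v' x ^+ 2) ^+ 2 = 1 - dot v' x ^+ 2.
  move=> Cx; rewrite sqr_sqrtr // subr_ge0.
  by apply: le_trans (cauchy_schwarz v' x) _; rewrite v1 mul1r CB.
have Cr (u : 'rV[R]_n) : dot u u = 1 -> forall a, a ^+ 2 <= r ^+ 2 -> C (a *: u).
  move=> u1 a ar; apply/rC/cballP; rewrite ?dotZl ?dotZr ?u1 ?mulr1 -?expr2 //.
  exact: ltW.
have rho2 : rho ^+ 2 = 1 - r ^+ 2.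
  rewrite sqr_sqrtr // subr_ge0; apply: le_trans (_ : c ^+ 2 <= 1); last first.
    by rewrite -cs lerDl sqr_ge0.
  by rewrite ler_sqr ?nnegrE //; lra.
have [x [Cx xE xm]] := maxval_max w C0 cC.
have [z [Cz zE zm]] := minval_min w C0 cC.
have [y [[Cy yv] yE _]] := face_min v w C0 cC.
have ym u : C u -> dot v' u <= dot v' y.
  have [y' [_ y'E y'm]] := maxval_max v C0 cC.
  by move=> /y'm; rewrite y'E -yv !vE ler_pM2l.
have w'm u : C u -> dot w' z <= dot w' u <= dot w' x.
  by move=> Cu; have := zm _ Cu; have := xm _ Cu; rewrite !wE !ler_pM2l // => -> ->.
(* Numerator and denominator share the factor [enorm w], so only the normalised [w'] remains. *)
rewrite /scaled_loss /loss /rangeval -yE -zE -xE !wE -!mulrBr invfM mulrACA.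
rewrite divff ?gt_eqF // mul1r.
(* These three points of the inner ball give [h >= r], [M >= r] and [m <= - r] in [planar_bound]. *)
have Crv : C (r *: v') by exact: Cr.
have Crw : C (r *: w') by exact: Cr.
have Cnrw : C (- r *: w') by apply: Cr => //; rewrite sqrrN.
apply: (@planar_bound _ r c s rho (dot v' y) (Num.sqrt (1 - dot v' y ^+ 2))
  (dot v' x) (Num.sqrt (1 - dot v' x ^+ 2))) => //.
- exact: sqrtr_ge0.
- by have := ym _ Crv; rewrite dotZr v1 mulr1.
- exact: sqE.
- by have := dev _ Cy; rewrite ler_norml => /andP[]; lra.
- exact: ym.
- exact: sqE.
- by have := dev _ Cx; rewrite ler_norml => /andP[]; lra.
- apply: le_trans (ler_norm _) _.
  by apply: unit_dot_bound => //; rewrite expr1n CB.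
- by have /andP[_] := w'm _ Crw; rewrite dotZr w1 mulr1.
- by have /andP[+ _] := w'm _ Cnrw; rewrite dotZr w1 mulr1.
Qed.

(** * Tightness *)

(** For unit [v] and [w] the cuts are tangent to the inner ball, at the tightest levels it
    permits. *)
Definition extremal_body (R : realType) (n : nat) (r : R) (v w : 'rV[R]_n) :
    set 'rV[R]_n :=
  cball n 1 `&` [set x | dot v x <= r /\ - r <= dot w x].

Lemma compact_extremal_body (R : realType) (n : nat) (r : R) (v w : 'rV[R]_n) :
  compact (extremal_body r v w).
Proof.
apply: compact_closedI; first exact: compact_cball ler01.
rewrite (_ : [set x | _] =
  [set x | dot v x <= r] `&` [set x | dot (- w) x <= r]).
  by apply: closedI; exact: closed_halfspace.
by apply/seteqP; split=> x /= [? H]; split=> //;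
  move: H; rewrite -(scaleN1r w) dotZl mulN1r lerNl.
Qed.

Lemma cball_sub_extremal_body (R : realType) (n : nat) (r : R)
    (v w : 'rV[R]_n) :
  0 <= r -> r <= 1 -> dot v v = 1 -> dot w w = 1 ->
  cball n r `<=` extremal_body r v w.
Proof.
move=> r0 r1 v1 w1 x /(cballP x r0) xr; split.
  by apply/cballP => //; apply: le_trans xr _; rewrite ler_sqr ?nnegrE.
have := unit_dot_bound r0 v1 xr; have := unit_dot_bound r0 w1 xr.
by rewrite !ler_norml /= => /andP[-> _] /andP[_ ->].
Qed.

Lemma scaled_loss_extremal_body (R : realType) (n : nat) (r c s : R)
    (v e : 'rV[R]_n) :
  0 < r -> r <= c -> 0 < s -> s <= r -> c ^+ 2 + s ^+ 2 = 1 ->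
  dot v v = 1 -> dot e e = 1 -> dot v e = 0 ->
  let rho := Num.sqrt (1 - r ^+ 2) in
  let w := c *: v + s *: e in
  scaled_loss (extremal_body r v w) v w =
    2 * rho * s / (r * (1 + c) + rho * s).
Proof.
move=> r0 rc s0 sr cs v1 e1 ve rho w.
have ev : dot e v = 0 by rewrite dotC.
have vw : dot v w = c by rewrite dotDr !dotZr v1 ve; ring.
have w1 : dot w w = 1.
  by rewrite !(dotDl, dotDr, dotZl, dotZr) v1 ve ev e1 -[RHS]cs; ring.
have c1 : c <= 1.
  by rewrite -ler_sqr ?nnegrE ?expr1n //; have := sqr_ge0 s; lra.
have r1 : r <= 1 by lra.
have rc2 : r ^+ 2 <= c ^+ 2 by rewrite ler_sqr ?nnegrE; lra.
have rho2 : rho ^+ 2 = 1 - r ^+ 2.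
  by rewrite sqr_sqrtr // subr_ge0; have := sqr_ge0 s; lra.
have rho0 : 0 <= rho by exact: sqrtr_ge0.
have rhos : rho * s <= r.
  apply: le_trans sr; rewrite ler_piMl ?(ltW s0) //.
  by rewrite -[leRHS]sqrtr1 ler_wsqrtr // gerBl sqr_ge0.
have rc0 : 0 < r * c by apply: mulr_gt0; lra.
set C := extremal_body r v w.
have rC := cball_sub_extremal_body (ltW r0) r1 v1 w1.
have cC : compact C by exact: compact_extremal_body.
have C0 : C !=set0.
  by exists 0; apply/rC/cballP; rewrite ?dot0l ?sqr_ge0 // ltW.
have dev x : C x -> `|dot w x - c * dot v x| <= s * Num.sqrt (1 - dot v x ^+ 2).
  move=> [/(cballP x ler01)]; rewrite expr1n => x1 _.
  by apply: dot_deviation => //; exact: ltW.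
(* For [b = rho] and [b = - rho] these are the points of the unit circle in the plane of [v] and [e]
   where [v] takes the value [r]: the first maximises [w] over [C], the second minimises it over the
   face. *)
pose p (b : R) := r *: v + b *: e.
have vp b : dot v (p b) = r by rewrite dotDr !dotZr v1 ve; ring.
have wp b : dot w (p b) = c * r + s * b.
  by rewrite !(dotDl, dotDr, dotZl, dotZr) v1 ve ev e1; ring.
have Cp b : b ^+ 2 = rho ^+ 2 -> - r <= c * r + s * b -> C (p b).
  move=> b2 H; split; last by split; rewrite /= ?vp ?wp.
  apply/cballP => //; rewrite !(dotDl, dotDr, dotZl, dotZr) v1 ve ev e1.
  have -> : r * (r * 1 + b * 0) + b * (r * 0 + b * 1) = r ^+ 2 + b ^+ 2 by ring.
  by rewrite b2 rho2 expr1n addrC subrK.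
have Cp1 : C (p rho) by apply: Cp => //; have := mulr_ge0 (ltW s0) rho0; lra.
(* The cut in direction [w] spares this point because [rho * s <= r]. *)
have Cp2 : C (p (- rho)) by apply: Cp; rewrite ?sqrrN //; lra.
have vmax : maxval C v = r.
  have [x [[_ [/= xr _]] xE xm]] := maxval_max v C0 cC.
  by rewrite -xE; apply/eqP; rewrite eq_le xr -(vp rho) xm.
have wmin : minval C w = - r.
  have [x [[_ [_ /= xr]] xE xm]] := minval_min w C0 cC.
  rewrite -xE; apply/eqP; rewrite eq_le xr andbT.
  have := xm (- r *: w); rewrite dotZr w1 mulr1; apply.
  by apply/rC/cballP; rewrite ?(ltW r0) // dotZl dotZr w1; nra.
have wmax : maxval C w = c * r + s * rho.
  have [x [Cx xE xm]] := maxval_max w C0 cC.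
  rewrite -xE; apply/eqP; rewrite eq_le -{2}wp xm // andbT.
  have := dev _ Cx; rewrite ler_norml => /andP[_ wx].
  apply: le_trans (_ : c * dot v x + s * Num.sqrt (1 - dot v x ^+ 2) <= _).
    by lra.
  (* Here [h = r] and [q = rho]: the cut gives [dot v x <= r], and [r <= c]. *)
  apply: arc_le => //; first by case: Cx => _ [].
  rewrite sqr_sqrtr // subr_ge0; apply: le_trans (cauchy_schwarz v x) _.
  by rewrite v1 mul1r; case: Cx => /(cballP x ler01); rewrite expr1n.
have wface : inf [set dot w x | x in face C v] = c * r - s * rho.
  have [x [[Cx xv] xE xm]] := face_min v w C0 cC.
  rewrite -xE; apply/eqP; rewrite eq_le; apply/andP; split.
    have := xm (p (- rho)); rewrite wp mulrN; apply; split=> //.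
    by rewrite vp vmax.
  have := dev _ Cx; rewrite xv vmax -/rho ler_norml => /andP[]; lra.
rewrite /scaled_loss /loss /rangeval wface wmax wmin.
by congr (_ / _); ring.
Qed.

Theorem theorem1 (R : realType) :
  (forall (n : nat) (r alpha : R) (C : set 'rV[R]_n) (v w : 'rV[R]_n),
      (0 < n)%N ->
      0 < r -> r < 1 ->
      0 < alpha -> alpha < pi / 2 ->
      sin alpha <= r -> r <= cos alpha ->
      compact C -> cball n r `<=` C -> C `<=` cball n 1 ->
      v != 0 -> w != 0 -> angle v w = alpha ->
      let rho := Num.sqrt (1 - r ^+ 2) in
      scaled_loss C v w <=
        2 * rho * sin alpha / (r * (1 + cos alpha) + rho * sin alpha))
  /\
  (forall r alpha : R,
      0 < r -> r < 1 ->
      0 < alpha -> alpha < pi / 2 ->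
      sin alpha <= r -> r <= cos alpha ->
      exists (n : nat) (C : set 'rV[R]_n) (v w : 'rV[R]_n),
        (0 < n)%N /\
        compact C /\ cball n r `<=` C /\ C `<=` cball n 1 /\
        v != 0 /\ w != 0 /\ angle v w = alpha /\
        let rho := Num.sqrt (1 - r ^+ 2) in
        scaled_loss C v w =
          2 * rho * sin alpha / (r * (1 + cos alpha) + rho * sin alpha)).
Proof.
have cs a : cos a ^+ 2 + sin a ^+ 2 = 1 :> R by exact: cos2Dsin2.
have a_pi (a : R) : a < pi / 2 -> a < pi.
  by move=> /lt_le_trans; apply; have := pi_gt0 R; lra.
split.
  move=> n r a C v w _ r0 r1 a0 /a_pi api sr rc cC rC C1 v0 w0 avw.
  have s0 : 0 < sin a by apply: sin_gt0_pi; rewrite a0.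
  apply: scaled_loss_le => //.
  have vw0 : 0 < enorm v * enorm w by rewrite mulr_gt0 ?enorm_gt0.
  (* Cancelling [acos] requires the quotient to lie in [[-1, 1]], which is Cauchy-Schwarz. *)
  rewrite -avw acosK ?divfK ?gt_eqF // in_itv /= -ler_norml.
  rewrite normrM normfV (gtr0_norm vw0) ler_pdivrMr // mul1r.
  rewrite -ler_sqr ?nnegrE ?(ltW vw0) // real_normK ?num_real //.
  by rewrite exprMn !sqr_enorm cauchy_schwarz.
move=> r a r0 r1 a0 /a_pi api sr rc.
have s0 : 0 < sin a by apply: sin_gt0_pi; rewrite a0.
(* The standard basis of the plane supplies the orthonormal pair; [w] is [v] rotated by the angle
   [a]. *)
pose v : 'rV[R]_2 := delta_mx 0 0; pose e : 'rV[R]_2 := delta_mx 0 1.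
have dot_delta i j : dot (delta_mx 0 i : 'rV[R]_2) (delta_mx 0 j) = (i == j)%:R.
  by rewrite /dot trmx_delta mul_delta_mx_cond -scaler_nat !mxE mulr1.
have v1 : dot v v = 1 by rewrite dot_delta.
have e1 : dot e e = 1 by rewrite dot_delta.
have ve : dot v e = 0 by rewrite dot_delta.
pose w := cos a *: v + sin a *: e.
have vw : dot v w = cos a by rewrite dotDr !dotZr v1 ve mulr1 mulr0 addr0.
have w1 : dot w w = 1.
  by rewrite dotDl !dotZl vw (dotC e) dotDl !dotZl ve e1 mulr0 add0r mulr1 -!expr2.
exists 2%N, (extremal_body r v w), v, w; split=> //.
split; first exact: compact_extremal_body.
split; first by apply: cball_sub_extremal_body => //; exact: ltW.
split; first by move=> x [].
split; first by rewrite -dot_eq0 v1 oner_neq0.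
split; first by rewrite -dot_eq0 w1 oner_neq0.
split; last exact: scaled_loss_extremal_body.
rewrite /angle /enorm v1 w1 vw sqrtr1 mulr1 divr1 cosK //.
by rewrite in_itv /= !ltW.
Qed.
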